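(* Let $V$ be a finite nonempty set, $P=(P_{x,y})_{x,y\in V}$ a strictly sub-stochastic and irreducible transition kernel, $\lambda\in[0,\infty)^V$, $\sigma\in[0,1]^V$, $\nu\in[0,\infty)^V$, and $n\ge1$ an integer. Consider the village model of activated random walk with $n$ houses per village constructed from the instruction stacks $\zeta,\gamma,\kappa$, its scaled jump odometer $m_*^{(n)}$ and scaled final sleepy particle counter $s_*^{(n)}$, and the random functions $\phi^{(n)}$ and $s^{(n)}$ built from the same stacks. Then for almost all realizations of the instruction stacks $\zeta,\gamma,\kappa$, $$\phi^{(n)}(m_*^{(n)})=m_*^{(n)}\qquad\text{and}\qquad s^{(n)}(m_*^{(n)})=s_*^{(n)}.$$
   Context: Strictly sub-stochastic and irreducible means: $P_{x,y}\ge 0$ for all $x,y\in V$; $\sum_{y\in V}P_{x,y}\le 1$ for all $x\in V$, with strict inequality for at least one $x$; and for all $x,y\in V$ there is an integer $\ell\ge 0$ with $(P^\ell)_{x,y}>0$. Write $[n]=\{1,\dots,n\}$. Sites are pairs $(x,i)\in V\times[n]$, called house $i$ of village $x$. For each $x$, exactly $\lfloor\sigma_xn\rfloor$ houses of village $x$ are fixed (deterministically) to contain initially one sleepy particle each; $\sigma_{x,i}=1$ if $(x,i)$ is such a house, $\sigma_{x,i}=0$ otherwise. Stacks. All the following variables are independent. For $x\in V$, $(\zeta_{j,x})_{j\ge1}$ are i.i.d. (''airplane tickets'') with $\mathbb{P}(\zeta_{j,x}=y)=P_{x,y}$ for $y\in V$ and $\mathbb{P}(\zeta_{j,x}=\dagger)=1-\sum_yP_{x,y}$,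 where $\dagger$ is a graveyard state. For $x\in V$, $(\gamma_{j,x})_{j\ge1}$ are i.i.d. uniform on $[n]$ (''taxi tickets''). For $x\in V,i\in[n]$, $(\kappa_{j,(x,i)})_{j\ge1}$ are i.i.d. Bernoulli (''landlord notices''), equal to $0$ (sleep) with probability $\frac{\lambda_x}{1+\lambda_x}$ and $1$ (jump) with probability $\frac1{1+\lambda_x}$. The process from stacks. Each stack is used in ascending order of $j$, each instruction at most once. (1) Start with the initial sleepy particles; for each $x$, $\lfloor\nu_xn\rfloor$ active particles arrive in village $x$ and are distributed to its houses by the taxi tickets $\gamma_{1,x},\dots,\gamma_{\lfloor\nu_xn\rfloor,x}$. A sleepy particle becomes active immediately when another particle arrives in its house. (2) Each active particle in village $x$ has an independent exponential clock of rate $1+\lambda_x$ (the clocks being independent of the stacks). When the first clock among all active particles rings, for a particle in house $(x,i)$ say, the next unused landlord notice of house $(x,i)$ is revealed. If it is $0$, the particle falls asleep if it is alone in the house, and nothing happens if there is another particle in the house. (3) If it is $1$, the particle jumps: it uses the next airplane ticket $\zeta_{\cdot,x}$; if that equals $\dagger$ the particle disappears, and if it equals $y\in V$ the particle moves to the house of village $y$ given by the next taxi ticket $\gamma_{\cdot,y}$. Steps (2)–(3) are repeated until all remaining particles are asleep, which happens almost surely after finitely many steps. Let $M_*^{(n)}(x)$ be the number of times a particle jumped from a house in village $x$ (step (3)), and $S_*^{(n)}(x)$ the number of sleepy particles in village $x$ in the final configuration; $m_*^{(n)}=\frac1n(M_*^{(n)}(x))_{x\in V}$, $s_*^{(n)}=\frac1n(S_*^{(n)}(x))_{x\in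 V}$. (Almost surely these do not depend on the order in which active particles are toppled.) Single-loop functions. For $M\in\mathbb{N}_0^V$ and $x\in V$ set: $I_x=\lfloor\nu_xn\rfloor+\sum_{y\in V}\sum_{j=1}^{M_y}\mathbf 1\{\zeta_{j,y}=x\}$; $\mathcal A_x=\{i\in[n]:\exists j\in\{1,\dots,I_x\},\ \gamma_{j,x}=i\}$ and $A_x=|\mathcal A_x|$; $Q_x=\sum_{i=1}^n\mathbf 1\{\sigma_{x,i}=1,\ \gamma_{j,x}\ne i\ \forall j\in\{1,\dots,I_x\}\}$; for $i\in\mathcal A_x$, $T_{x,i}=\sigma_{x,i}+\sum_{j=1}^{I_x}\mathbf 1\{\gamma_{j,x}=i\}$ and $N_{x,i}=\min\{K\in\mathbb{N}_0:\sum_{j=1}^K\kappa_{j,(x,i)}=T_{x,i}-1\}$; $J_x=\sum_{i\in\mathcal A_x}\kappa_{N_{x,i}+1,(x,i)}$. Define $$\Phi^{(n)}(M)_x=\lfloor\sigma_xn\rfloor-Q_x+I_x-A_x+J_x,\qquad S^{(n)}(M)_x=-M_x+\lfloor\sigma_xn\rfloor+I_x,$$ and for $m\in[0,\infty)^V$, with coordinatewise integer part, $\phi^{(n)}(m)=\frac1n\Phi^{(n)}(\lfloor nm\rfloor)$ and $s^{(n)}(m)=\frac1nS^{(n)}(\lfloor nm\rfloor)$. *)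

(* Defs.v *)
From HB Require Import structures.
From mathcomp Require Import all_boot all_order all_algebra.
From mathcomp Require Import all_classical all_reals all_analysis.
Set Implicit Arguments.
Unset Strict Implicit.
Unset Printing Implicit Defensive.
Import Order.TTheory GRing.Theory Num.Theory.
Local Open Scope classical_set_scope.
Local Open Scope ring_scope.

Fixpoint kernel_pow (R : realType) (V : finType) (p : V -> V -> R) (l : nat)
    (x y : V) : R :=
  if l is l'.+1 then \sum_(z : V) p x z * kernel_pow p l' z y
  else (x == y)%:R.

Record strictly_substochastic_irreducible (R : realType) (V : finType)
    (p : V -> V -> R) : Prop := {
  kernel_ge0 : forall x y, 0 <= p x y ;
  kernel_sum_le1 : forall x, \sum_(y : V) p x y <= 1 ;
  kernel_sum_lt1 : exists x, \sum_(y : V) p x y < 1 ;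
  kernel_irreducible : forall x y, exists l : nat, 0 < kernel_pow p l x y }.

(* One realization of all the stacks.  Stacks are indexed from 0, so that the
   j-th instruction (j >= 1) of a stack has index j - 1.  [None] is the
   graveyard; a landlord notice is [true] for "jump" (value 1) and [false] for
   "sleep" (value 0). *)
Record stacks (V : finType) (n : nat) := Stacks {
  airplane : V -> nat -> option V ;
  taxi : V -> nat -> 'I_n ;
  notice : V * 'I_n -> nat -> bool }.

(* A configuration together with the number of instructions already used on
   each stack.  [jumps c x] is the number of used airplane tickets of village x,
   that is, the number of jumps made so far from houses of x; [arrivals c x] is
   the number of its used taxi tickets. *)
Record config (V : finType) (n : nat) := Config {
  active : V * 'I_n -> nat ;
  asleep : V * 'I_n -> bool ;
  jumps : V -> nat ;
  arrivals : V -> nat ;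
  notices : V * 'I_n -> nat }.

Section Process.
Context (R : realType) (V : finType) (n : nat).
Implicit Types (st : stacks V n) (c : config V n) (h : V * 'I_n).

(* A particle already asleep in the house is woken up by the arrival. *)
Definition arrive st (y : V) c : config V n :=
  let h := (y, taxi st y (arrivals c y)) in
  Config [eta active c with h |-> (active c h + asleep c h + 1)%N]
         [eta asleep c with h |-> false]
         (jumps c)
         [eta arrivals c with y |-> (arrivals c y).+1]
         (notices c).

Definition start (sleepy0 : V -> {set 'I_n}) : config V n :=
  Config (fun=> 0%N) (fun h => h.2 \in sleepy0 h.1)
         (fun=> 0%N) (fun=> 0%N) (fun=> 0%N).

Definition init st (sleepy0 : V -> {set 'I_n}) (nu : V -> R) : config V n :=
  foldl (fun c x => iter (Num.truncn (nu x * n%:R)) (arrive st x) c)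
        (start sleepy0) (enum V).

Definition topple st c h : config V n :=
  let used := [eta notices c with h |-> (notices c h).+1] in
  if notice st h (notices c h) then
    let c' := Config [eta active c with h |-> (active c h).-1] (asleep c)
                     [eta jumps c with h.1 |-> (jumps c h.1).+1]
                     (arrivals c) used in
    if airplane st h.1 (jumps c h.1) is Some y then arrive st y c' else c'
  else if (active c h + asleep c h == 1)%N then
    Config [eta active c with h |-> 0%N] [eta asleep c with h |-> true]
           (jumps c) (arrivals c) used
  else Config (active c) (asleep c) (jumps c) (arrivals c) used.

(* The active particles: those of house h are numbered 0, 1, .... *)
Definition particle c : finType := {h : V * 'I_n & 'I_(active c h)}.

(* [e h q] is the clock of particle number q of house h; the active particle
   whose clock rings first is toppled. *)
Definition step st (e : V * 'I_n -> nat -> R) c : config V n :=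
  let ring (a : particle c) : R := e (tag a) (tagged a) in
  if [pick a : particle c | [forall b : particle c, ring a <= ring b]] is Some a
  then topple st c (tag a) else c.

Definition stable c : bool := [forall h, active c h == 0%N].

Section Run.
Context (st : stacks V n) (clock : nat -> V * 'I_n -> nat -> R)
  (sleepy0 : V -> {set 'I_n}) (nu : V -> R).

Fixpoint run (k : nat) : config V n :=
  if k is k'.+1 then step st (clock k') (run k') else init st sleepy0 nu.

(* [step] leaves stable configurations unchanged, so any k with [run k] stable
   gives the same configuration.  The process stabilizes almost surely; [run 0]
   is a default for the exceptional realizations. *)
Definition final : config V n := run (xget 0%N [set k | stable (run k)]).

Definition mstar (x : V) : R := (jumps final x)%:R / n%:R.

Definition sstar (x : V) : R := #|[pred i : 'I_n | asleep final (x, i)]|%:R / n%:R.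

End Run.

Section SingleLoop.
Context (st : stacks V n) (sleepy0 : V -> {set 'I_n}) (sig nu : V -> R)
  (M : V -> nat).

Definition loop_I (x : V) : nat :=
  (Num.truncn (nu x * n%:R)
   + \sum_(y : V) \sum_(j < M y) (airplane st y j == Some x))%N.

Definition loop_A (x : V) : {set 'I_n} :=
  [set i | [exists j : 'I_(loop_I x), taxi st x j == i]].

Definition loop_Q (x : V) : nat :=
  (\sum_(i < n) ((i \in sleepy0 x)
                 && [forall j : 'I_(loop_I x), taxi st x j != i]))%N.

Definition loop_T (x : V) (i : 'I_n) : nat :=
  ((i \in sleepy0 x) + \sum_(j < loop_I x) (taxi st x j == i))%N.

(* The minimum; it exists for all M almost surely, and is 0 by default. *)
Definition loop_N (x : V) (i : 'I_n) : nat :=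
  let reached K := (\sum_(j < K) notice st (x, i) j == (loop_T x i).-1)%N in
  xget 0%N [set K | reached K /\ forall K', reached K' -> (K <= K')%N].

(* Notice number N + 1 has index N. *)
Definition loop_J (x : V) : nat :=
  (\sum_(i in loop_A x) notice st (x, i) (loop_N x i))%N.

Definition loop_Phi (x : V) : int :=
  (Num.truncn (sig x * n%:R))%:Z - (loop_Q x)%:Z + (loop_I x)%:Z
  - #|loop_A x|%:Z + (loop_J x)%:Z.

Definition loop_S (x : V) : int :=
  - (M x)%:Z + (Num.truncn (sig x * n%:R))%:Z + (loop_I x)%:Z.

End SingleLoop.

(* [Num.truncn] is the integer part of a nonnegative number; phi_n and s_n are
   meant for m with nonnegative coordinates. *)
Definition phi_n st sleepy0 (sig nu : V -> R) (m : V -> R) (x : V) : R :=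
  (loop_Phi st sleepy0 sig nu (fun y => Num.truncn (n%:R * m y)) x)%:~R / n%:R.

Definition s_n st (sig nu : V -> R) (m : V -> R) (x : V) : R :=
  (loop_S st sig nu (fun y => Num.truncn (n%:R * m y)) x)%:~R / n%:R.

End Process.

(* Mutual independence of a family of classes of events. *)
Definition mutual_independence (R : realType) (d : measure_display)
    (T : measurableType d) (Pr : probability T R) (I : eqType)
    (F : I -> set (set T)) : Prop :=
  forall (r : seq I) (E : I -> set T), uniq r ->
    (forall i, i \in r -> F i (E i)) ->
    Pr (\bigcap_(i in [set` r]) E i) = (\prod_(i <- r) Pr (E i))%E.

Section Randomness.
Context (R : realType) (d : measure_display) (T : measurableType d)
  (Pr : probability T R) (V : finType) (n : nat).

(* Indices of the random variables: airplane tickets, taxi tickets, landlord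
   notices and clocks. *)
Definition source : eqType :=
  (V * nat + V * nat + (V * 'I_n) * nat + nat * (V * 'I_n) * nat)%type.

(* The sigma-algebra generated by each variable; the first three kinds take
   values in finite types, where all subsets are measurable. *)
Definition source_events (st : T -> stacks V n)
    (clock : nat -> V * 'I_n -> nat -> {RV Pr >-> R}) (i : source) :
    set (set T) :=
  match i with
  | inl (inl (inl (x, j))) =>
      [set (fun w => airplane (st w) x j) @^-1` B | B in [set: set (option V)]]
  | inl (inl (inr (x, j))) =>
      [set (fun w => taxi (st w) x j) @^-1` B | B in [set: set 'I_n]]
  | inl (inr (h, j)) =>
      [set (fun w => notice (st w) h j) @^-1` B | B in [set: set bool]]
  | inr (k, h, q) => [set clock k h q @^-1` B | B in measurable]
  end.

(* [clock k h q] is the clock used at step k for particle number q of house h: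
   as exponential clocks are memoryless, they are drawn afresh at each step. *)
Record village_model (p : V -> V -> R) (lam : V -> R) (st : T -> stacks V n)
    (clock : nat -> V * 'I_n -> nat -> {RV Pr >-> R}) : Prop := {
  airplane_measurable : forall x j v,
    measurable [set w | airplane (st w) x j = v] ;
  taxi_measurable : forall x j i, measurable [set w | taxi (st w) x j = i] ;
  notice_measurable : forall h j b,
    measurable [set w | notice (st w) h j = b] ;
  airplane_law : forall x j y,
    Pr [set w | airplane (st w) x j = Some y] = (p x y)%:E ;
  airplane_graveyard : forall x j,
    Pr [set w | airplane (st w) x j = None] = (1 - \sum_(y : V) p x y)%:E ;
  taxi_law : forall x j i,
    Pr [set w | taxi (st w) x j = i] = (n%:R^-1)%:E ;
  notice_sleep : forall h j,
    Pr [set w | notice (st w) h j = false] = (lam h.1 / (1 + lam h.1))%:E ;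
  notice_jump : forall h j,
    Pr [set w | notice (st w) h j = true] = (1 / (1 + lam h.1))%:E ;
  clock_law : forall k h q (B : set R), measurable B ->
    distribution Pr (clock k h q) B = exponential_prob (1 + lam h.1) B ;
  all_independent : mutual_independence Pr (source_events st clock) }.

End Randomness.

(* Main.v *)
(* Once the process has stabilized, the single-loop functions evaluated at the
   jump odometer only count instructions already used.  In a house visited at
   least once with total load T, either all T particles departed, or T - 1 did
   and the last one sleeps; the first notice revealed after the (T - 1)-st
   departure is a jump in the first case and a sleep notice in the second, so J
   corrects the count I - A exactly.

   Stabilization holds for every choice of clocks as soon as every landlord
   stack contains infinitely many jump notices and every airplane stack contains
   infinitely often each ticket of positive probability, which holds almost
   surely by independence.  Indeed, in an infinite run some village jumps
   infinitely often; as the number of particles is bounded, so does each village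
   it sends particles to, hence by irreducibility every village, in particular
   one that sends particles to the graveyard infinitely often, which contradicts
   the conservation of particles. *)

Require Import Defs.
From HB Require Import structures.
From mathcomp Require Import all_boot all_order all_algebra.
From mathcomp Require Import all_classical all_reals all_analysis.
From mathcomp Require Import zify.
Set Implicit Arguments.
Unset Strict Implicit.
Unset Printing Implicit Defensive.
Import Order.TTheory GRing.Theory Num.Theory.
Local Open Scope classical_set_scope.
Local Open Scope ring_scope.

(** * Invariants preserved by one arrival and one toppling *)

Section Configurations.
Context (V : finType) (n : nat) (st : stacks V n) (sleepy0 : V -> {set 'I_n}).
Implicit Types (c : config V n) (h : V * 'I_n).

Definition hits h (a : nat) : nat := (\sum_(j < a) (taxi st h.1 j == h.2))%N.

Definition load h (a : nat) : nat := ((h.2 \in sleepy0 h.1) + hits h a)%N.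

Definition departures h (K : nat) : nat := (\sum_(j < K) notice st h j)%N.

Lemma hitsS h a : hits h a.+1 = (hits h a + (taxi st h.1 a == h.2))%N.
Proof. by rewrite /hits big_ord_recr. Qed.

Lemma departuresS h K : departures h K.+1 = (departures h K + notice st h K)%N.
Proof. by rewrite /departures big_ord_recr. Qed.

Lemma departures_mono h : {homo departures h : K L / (K <= L)%N}.
Proof.
apply: (homo_leq leqnn leq_trans) => K.
by rewrite departuresS leq_addr.
Qed.

(* [valid_room]: a notice is used only while the house is occupied.
   [valid_sleep]: a sleep notice used when one particle less than the current
   total load has departed put the last particle to sleep for good. *)
Record valid c : Prop := {
  valid_mass h :
    (active c h + asleep c h + departures h (notices c h))%N
    = load h (arrivals c h.1) ;
  valid_excl h : asleep c h -> active c h = 0%N ;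
  valid_unhit h : hits h (arrivals c h.1) = 0%N ->
    active c h = 0%N /\ notices c h = 0%N ;
  valid_room h K : (K < notices c h)%N ->
    (departures h K < load h (arrivals c h.1))%N ;
  valid_sleep h K : (K < notices c h)%N -> ~~ notice st h K ->
    (departures h K).+1 = load h (arrivals c h.1) -> asleep c h ;
  valid_last h : asleep c h -> (0 < hits h (arrivals c h.1))%N ->
    exists2 K, notices c h = K.+1 & ~~ notice st h K ;
  valid_jumps x :
    jumps c x = (\sum_(i < n) departures (x, i) (notices c (x, i)))%N }.

Lemma valid_start : valid (start sleepy0).
Proof.
split=> //=.
- by move=> h; rewrite /load /departures /hits !big_ord0.
- by move=> h; rewrite /hits big_ord0.
- by move=> x; rewrite big1 // => i _; rewrite /departures big_ord0.
Qed.

Lemma hits_arrive c y h :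
  hits h (arrivals (arrive st y c) h.1)
  = (hits h (arrivals c h.1) + (h == (y, taxi st y (arrivals c y))))%N.
Proof.
case: h => x i /=; rewrite xpair_eqE; case: eqP => [->|_] /=; last by rewrite addn0.
by rewrite hitsS /= eq_sym.
Qed.

Lemma valid_arrive c y : valid c -> valid (arrive st y c).
Proof.
move=> [mass excl unhit room sleep last jmp].
have loadE h : load h (arrivals (arrive st y c) h.1)
  = (load h (arrivals c h.1) + (h == (y, taxi st y (arrivals c y))))%N.
  by rewrite /load hits_arrive addnA.
split=> [h|h|h|h K|h K|h|x] //; rewrite ?loadE ?hits_arrive /=.
- by have := mass h; case: eqP => [<-|_] /=; lia.
- by case: eqP => //= _; apply: excl.
- by case: eqP => [_|_]; rewrite ?addn1 // addn0; apply: unhit.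
- by move=> /room; lia.
(* In the house of arrival the premise fails: by [valid_room] the departures before notice K were
   below the old load, so one more cannot equal the increased load. *)
- move=> lK nK; case: eqP => [_|_] /=; last by rewrite addn0; apply: sleep.
  by have := room _ _ lK; lia.
- by case: eqP => //= _; rewrite addn0; apply: last.
- exact: jmp.
Qed.

(** The jump branch of [topple] cut before the landing, so that leaving and arriving can be treated
    separately. *)
Definition depart c h : config V n :=
  Config [eta active c with h |-> (active c h).-1] (asleep c)
         [eta jumps c with h.1 |-> (jumps c h.1).+1]
         (arrivals c) [eta notices c with h |-> (notices c h).+1].

Lemma toppleE c h : topple st c h =
  let used := [eta notices c with h |-> (notices c h).+1] in
  if notice st h (notices c h) then
    if airplane st h.1 (jumps c h.1) is Some y then arrive st y (depart c h)
    else depart c h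
  else if (active c h + asleep c h == 1)%N then
    Config [eta active c with h |-> 0%N] [eta asleep c with h |-> true]
           (jumps c) (arrivals c) used
  else Config (active c) (asleep c) (jumps c) (arrivals c) used.
Proof. by []. Qed.

Lemma awake c h : valid c -> (0 < active c h)%N -> asleep c h = false.
Proof.
by move=> vc ah; apply/negP => /(valid_excl vc) a0; rewrite a0 in ah.
Qed.

(** The spent notice is a jump, so [valid_sleep] gains no new instance; the particle still present
    before the jump keeps the departures below the load, as [valid_room] asks. *)
Lemma valid_depart c h : valid c -> (0 < active c h)%N ->
  notice st h (notices c h) -> valid (depart c h).
Proof.
move=> vc ah nh; have sh := awake vc ah; have mh := valid_mass vc h.
have [mass excl unhit room sleep last jmp] := vc.
split=> [g|g|g|g K|g K|g|x] /=.
- have := mass g; case: eqP => [->|_] //.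
  by rewrite departuresS nh sh; lia.
- by case: eqP => [->|_]; [rewrite sh|apply: excl].
- by case: eqP => [->|_ /unhit//] /unhit [a0]; rewrite a0 in ah.
- case: eqP => [->|_]; last exact: room.
  rewrite ltnS leq_eqVlt => /orP[/eqP ->|]; last exact: room.
  by rewrite -mh; lia.
- case: eqP => [->|_]; last exact: sleep.
  rewrite ltnS leq_eqVlt => /orP[/eqP -> /negP//|lK].
  exact: sleep.
- by case: eqP => [->|_]; [rewrite sh|apply: last].
- case: h {ah sh mh} nh => y i /= nh; case: (eqVneq x y) => [->|xy]; last first.
    rewrite jmp; apply: eq_bigr => j _ /=.
    by rewrite xpair_eqE (negPf xy).
  rewrite jmp [LHS](_ : _ = (\sum_j (departures (y, j) (notices c (y, j))
    + (j == i)))%N); last first.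
    rewrite big_split /=.
    rewrite (bigD1 (P := predT) (F := fun j => nat_of_bool (j == i)) i) //=.
    rewrite eqxx [X in (_ + (_ + X))%N]big1 ?addn0 ?addn1 // => j /negPf -> //.
  apply: eq_bigr => j _; rewrite xpair_eqE eqxx /=.
  by case: eqP => [->|_]; rewrite ?addn0 // departuresS nh.
Qed.

Lemma valid_topple c h : valid c -> (0 < active c h)%N -> valid (topple st c h).
Proof.
move=> vc ah; rewrite toppleE /=.
case: ifPn => nh.
  have vd := valid_depart vc ah nh.
  by case: (airplane _ _ _) => // y; apply: valid_arrive.
have sh := awake vc ah; have mh := valid_mass vc h.
have [mass excl unhit room sleep last jmp] := vc.
have nh0 : nat_of_bool (notice st h (notices c h)) = 0%N by rewrite (negPf nh).
have dep g : departures g (if g == h then (notices c h).+1 else notices c g)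
  = departures g (notices c g).
  by case: eqP => // ->; rewrite departuresS nh0 addn0.
have [u r] : (forall g, hits g (arrivals c g.1) = 0%N -> g <> h) /\
  (forall g K, (K < if g == h then (notices c h).+1 else notices c g)%N ->
    (departures g K < load g (arrivals c g.1))%N).
  split=> [g /unhit [a0 _] gh|g K]; first by rewrite -gh a0 in ah.
  case: eqP => [->|_]; last exact: room.
  rewrite ltnS leq_eqVlt => /orP[/eqP ->|]; last exact: room.
  by rewrite -mh; lia.
have j0 x : jumps c x = (\sum_(i < n) departures (x, i)
   (if (x, i) == h then (notices c h).+1 else notices c (x, i)))%N.
  by rewrite jmp; apply: eq_bigr => i _; rewrite dep.
case: eqP => a1; split=> [g|g|g|g K|g K|g|x] //=.
- by rewrite dep; have := mass g; case: eqP => [->|_] //; lia.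
- by case: eqP => // _; apply: excl.
- by move=> /[dup] /u /eqP /negPf -> /unhit.
- exact: r.
- by case: eqP => // _; apply: sleep.
- by case: eqP => [-> _ _|_]; [exists (notices c h)|apply: last].
- by rewrite dep; apply: mass.
- exact: excl.
- by move=> /[dup] /u /eqP /negPf -> /unhit.
- exact: r.
- case: eqP => [->|_]; last exact: sleep.
  rewrite ltnS leq_eqVlt => /orP[/eqP -> _|]; last exact: sleep.
  (* If one departure were missing to the load, mass conservation would leave exactly one particle
     in the house, against [a1]. *)
  by rewrite -mh; lia.
- by case: eqP => [->|_]; [rewrite sh|apply: last].
Qed.

Lemma jumps_topple c h x : jumps (topple st c h) x
  = (jumps c x + (notice st h (notices c h) && (h.1 == x)))%N.
Proof.
rewrite toppleE /=; case: ifPn => _ /=; last by case: ifP; rewrite addn0.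
have -> : jumps (if airplane st h.1 (jumps c h.1) is Some y
  then arrive st y (depart c h) else depart c h) x = jumps (depart c h) x.
  by case: (airplane _ _ _).
by rewrite /= eq_sym; case: eqP => [->|_]; rewrite ?addn1 ?addn0.
Qed.

Lemma arrivals_topple c h x : arrivals (topple st c h) x
  = (arrivals c x + (notice st h (notices c h)
       && (airplane st h.1 (jumps c h.1) == Some x)))%N.
Proof.
rewrite toppleE /=; case: ifPn => _ /=; last by case: ifP; rewrite addn0.
case: (airplane _ _ _) => [y|] /=; last by rewrite addn0.
rewrite eq_sym (inj_eq (@Some_inj _)) eq_sym [x == y]eq_sym.
by case: eqP => [->|_]; rewrite ?addn1 ?addn0.
Qed.

Lemma notices_topple c h g :
  notices (topple st c h) g = (notices c g + (h == g))%N.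
Proof.
rewrite toppleE [h == g]eq_sym /=.
have E : (if g == h then (notices c h).+1 else notices c g)
  = (notices c g + (g == h))%N by case: eqP => [->|_]; rewrite ?addn1 ?addn0.
case: ifP => _; first by case: (airplane _ _ _).
by case: ifP.
Qed.

(** With [v] in [option V], the same count gives the sum in [loop_I] for [Some x] and the number of
    deaths for [None]. *)
Definition flights (M : V -> nat) (v : option V) : nat :=
  (\sum_(y : V) \sum_(j < M y) (airplane st y j == v))%N.

Lemma flights_topple c h v : flights (jumps (topple st c h)) v
  = (flights (jumps c) v + (notice st h (notices c h)
       && (airplane st h.1 (jumps c h.1) == v)))%N.
Proof.
rewrite /flights (bigD1 h.1) //= [in RHS](bigD1 h.1) //=.
rewrite jumps_topple eqxx andbT addnAC; congr (_ + _)%N; last first.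
  by apply: eq_bigr => y /negPf yh; rewrite jumps_topple eq_sym yh andbF addn0.
by case: (notice _ _ _); rewrite /= ?addn0 // addn1 big_ord_recr.
Qed.

End Configurations.

(** * Invariants along the whole run *)

Section Trajectory.
Context (R : realType) (V : finType) (n : nat) (st : stacks V n)
  (sleepy0 : V -> {set 'I_n}).
Implicit Types (c : config V n) (h : V * 'I_n).

(** When [arr0] is the number of initial arrivals, the right-hand side is I_x evaluated at the
    current jump counts. *)
Definition balanced (arr0 : V -> nat) c : Prop :=
  forall x, arrivals c x = (arr0 x + flights st (jumps c) (Some x))%N.

Lemma iter_arrive y k c : let c' := iter k (arrive st y) c in
  [/\ valid st sleepy0 c -> valid st sleepy0 c', jumps c' = jumps c
    & forall x, arrivals c' x = (arrivals c x + k * (y == x))%N].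
Proof.
elim: k => [|k [vk jk ak]] /=.
  by split=> // x; rewrite mul0n addn0.
split; [by move=> /vk; apply: valid_arrive|exact: jk|move=> x].
rewrite mulSn addnCA -ak /= [y == x]eq_sym.
by case: eqP => [->|_]; rewrite ?add1n.
Qed.

Lemma foldl_arrive (k : V -> nat) s c :
  let c' := foldl (fun c x => iter (k x) (arrive st x) c) c s in
  [/\ valid st sleepy0 c -> valid st sleepy0 c', jumps c' = jumps c
    & forall x, arrivals c' x = (arrivals c x + \sum_(y <- s) k y * (y == x))%N].
Proof.
elim: s c => [|y s IH] c /=; first by split=> // x; rewrite big_nil addn0.
have [v1 j1 a1] := iter_arrive y (k y) c.
have [v2 j2 a2] := IH (iter (k y) (arrive st y) c).
split; [by move=> /v1 /v2|by rewrite j2|move=> x].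
by rewrite a2 a1 big_cons addnA.
Qed.

Lemma init_spec (nu : V -> R) : let c := init st sleepy0 nu in
  valid st sleepy0 c /\ balanced (fun x => Num.truncn (nu x * n%:R)) c.
Proof.
have [v j a] := foldl_arrive (fun x => Num.truncn (nu x * n%:R)) (enum V)
  (start sleepy0).
split; first exact/v/valid_start.
move=> x; rewrite /init a j /= add0n /flights [X in (_ + X)%N]big1; last first.
  by move=> y _; rewrite big_ord0.
rewrite addn0 big_enum (bigD1 (P := predT)
  (F := fun y => (Num.truncn (nu y * n%:R) * (y == x))%N) x) //=.
by rewrite eqxx muln1 big1 ?addn0 // => y /negPf ->; rewrite muln0.
Qed.

Lemma balanced_topple arr0 c h : balanced arr0 c -> balanced arr0 (topple st c h).
Proof.
by move=> bc x; rewrite arrivals_topple flights_topple bc addnA.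
Qed.

Lemma step_stable (e : V * 'I_n -> nat -> R) c : stable c -> step st e c = c.
Proof.
move=> /forallP sc; rewrite /step; case: pickP => // -[h q].
by case: q => q /= + _; rewrite (eqP (sc h)).
Qed.

(** There are finitely many active particles, hence a minimal clock, and [pick] succeeds even when
    clocks tie. *)
Lemma step_topple (e : V * 'I_n -> nat -> R) c : ~~ stable c ->
  exists2 h, (0 < active c h)%N & step st e c = topple st c h.
Proof.
move=> /forallPn[h]; rewrite -lt0n => ah; rewrite /step.
pose ring (a : particle c) : R := e (tag a) (tagged a).
pose a0 : particle c := Tagged (fun g => 'I_(active c g)) (Ordinal ah).
case: pickP => [a _|none].
  by exists (tag a) => //; apply: leq_ltn_trans (ltn_ord (tagged a)).
case: (arg_minP (i0 := a0) (P := predT) ring isT) => a _ amin.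
by have /negP[] := negbT (none a); apply/forallP => b; apply: amin.
Qed.

Section Run.
Context (clock : nat -> V * 'I_n -> nat -> R) (nu : V -> R).

Lemma run_spec k : let c := run st clock sleepy0 nu k in
  valid st sleepy0 c /\ balanced (fun x => Num.truncn (nu x * n%:R)) c.
Proof.
elim: k => [|k [vk bk]] /=; first exact: init_spec.
case: (boolP (stable (run st clock sleepy0 nu k))) => [sk|/step_topple sk].
  by rewrite step_stable.
have [h ah ->] := sk (clock k).
by split; [apply: valid_topple|apply: balanced_topple].
Qed.

End Run.

(** Discrete intermediate values: the departure count starts at 0 and grows by at most 1 per notice.
    This provides the minimum that defines [loop_N]. *)
Lemma departures_reach h L m : (m <= departures st h L)%N ->
  exists K, [/\ (K <= L)%N, departures st h K = m
    & forall K', departures st h K' = m -> (K <= K')%N].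
Proof.
elim: L => [|L IH].
  rewrite /departures big_ord0 leqn0 => /eqP ->.
  by exists 0%N; rewrite big_ord0.
case: (leqP m (departures st h L)) => [/IH[K [KL Km Kmin]] _|mL].
  by exists K; split=> //; apply: leqW.
rewrite departuresS => mL1; exists L.+1; split=> //.
  by rewrite departuresS; case: (notice _ _ _) mL1; lia.
move=> K' K'm; rewrite ltnNge; apply/negP => /(departures_mono st h).
by rewrite K'm leqNgt mL.
Qed.

(** Double counting: each taxi ticket points to exactly one house of its village. *)
Lemma sum_load c x : (\sum_(i < n) load st sleepy0 (x, i) (arrivals c x))%N
  = (#|sleepy0 x| + arrivals c x)%N.
Proof.
rewrite big_split /= -sum1_card -big_mkcond /= exchange_big /=; congr (_ + _)%N.
rewrite -[RHS]card_ord -sum1_card; apply: eq_bigr => j _.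
rewrite (bigD1 (taxi st x j)) //= eqxx big1 // => i /negPf ti.
by rewrite eq_sym ti.
Qed.

(** * The single-loop functions evaluated at a stable configuration *)

Section Stable.
Context (sig nu : V -> R) (c : config V n).
Hypotheses (card_sleepy0 : forall x, #|sleepy0 x| = Num.truncn (sig x * n%:R))
  (vc : valid st sleepy0 c)
  (bc : balanced (fun x => Num.truncn (nu x * n%:R)) c) (sc : stable c).

Let active0 h : active c h = 0%N.
Proof. by apply/eqP/(forallP sc). Qed.

Lemma stable_mass h : (asleep c h + departures st h (notices c h))%N
  = load st sleepy0 h (arrivals c h.1).
Proof. by rewrite -(valid_mass vc) active0. Qed.

Lemma loop_I_stable x : loop_I st nu (jumps c) x = arrivals c x.
Proof. by rewrite bc. Qed.

Lemma in_loop_A x i : (i \in loop_A st nu (jumps c) x)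
  = (0 < hits st (x, i) (arrivals c x))%N.
Proof.
rewrite inE loop_I_stable lt0n /hits sum_nat_eq0 negb_forall.
by apply: eq_existsb => j /=; case: eqP.
Qed.

(** Let T be the load and K the first index with T - 1 departures before it. If the house ends
    asleep, its last used notice is a sleep notice preceded by T - 1 departures, and a jump at K
    would put T departures before it. If it ends empty, K was used, and a sleep notice there would
    contradict [valid_sleep]. *)
Lemma notice_loop_N x i : i \in loop_A st nu (jumps c) x ->
  notice st (x, i) (loop_N st sleepy0 nu (jumps c) x i) = ~~ asleep c (x, i).
Proof.
rewrite in_loop_A => hit; set h := (x, i).
have mh := stable_mass h; rewrite /= in mh.
have Tpos : (0 < load st sleepy0 h (arrivals c x))%N by rewrite addn_gt0 hit orbT.
have [K [Kn Kd Kmin]] : exists K, [/\ (K <= notices c h)%N,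
    departures st h K = (load st sleepy0 h (arrivals c x)).-1
    & forall K', departures st h K' = (load st sleepy0 h (arrivals c x)).-1 ->
      (K <= K')%N].
  by apply: departures_reach; case: (asleep c h) mh; lia.
(* [K] is a witness for the set in [xget], so the default 0 is not taken, and a minimum is
   unique. *)
have -> : loop_N st sleepy0 nu (jumps c) x i = K.
  rewrite /loop_N /loop_T loop_I_stable.
  case: xgetP => [K' _ [/eqP K'd K'min]|/(_ K) []]; last first.
    by split=> [|K' /eqP /Kmin //]; apply/eqP.
  by apply/eqP; rewrite eqn_leq Kmin // K'min //; apply/eqP.
case sh: (asleep c h) mh => /= mh.
  have [L nL nnL] := valid_last vc sh hit.
  have dL : departures st h L = (load st sleepy0 h (arrivals c x)).-1.
    by move: mh; rewrite nL departuresS (negPf nnL); lia.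
  apply/negbTE/negP => nK.
  have : (departures st h K.+1 <= departures st h L)%N.
    apply: departures_mono; rewrite ltn_neqAle (Kmin _ dL) andbT.
    by apply: contraNneq nnL => <-.
  by rewrite departuresS nK Kd dL; lia.
have KN : (K < notices c h)%N.
  by rewrite ltn_neqAle Kn andbT; apply/eqP => Ke; move: mh; rewrite -Ke Kd; lia.
apply: contraFT sh => nK; apply: (valid_sleep vc KN nK) => /=.
by rewrite Kd prednK.
Qed.

Lemma loop_Phi_stable x :
  loop_Phi st sleepy0 sig nu (jumps c) x = (jumps c x)%:Z.
Proof.
rewrite /loop_Phi.
(* Moving the subtracted terms across gives an identity in [nat] that holds house by house. A
   visited house has load plus J-term equal to 1 plus its departures; an unvisited one has load
   equal to its Q-term and no departures. *)
suff E : (#|sleepy0 x| + arrivals c x + loop_J st sleepy0 nu (jumps c) x)%N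
    = (loop_Q st sleepy0 nu (jumps c) x + #|loop_A st nu (jumps c) x| + jumps c x)%N.
  by rewrite loop_I_stable -card_sleepy0; lia.
rewrite -sum_load /loop_J [X in (_ + X)%N]big_mkcond /loop_Q -sum1_card.
rewrite [X in (_ + X + _)%N]big_mkcond.
rewrite (valid_jumps vc) -!big_split; apply: eq_bigr => i _ /=.
have := stable_mass (x, i) => /=; rewrite loop_I_stable.
have -> : [forall j : 'I_(arrivals c x), taxi st x j != i]
    = (i \notin loop_A st nu (jumps c) x).
  by rewrite inE loop_I_stable negb_exists.
case: ifPn => iA /=.
  by rewrite notice_loop_N // andbF; case: (asleep c (x, i)); lia.
move: iA; rewrite in_loop_A lt0n negbK => /eqP h0.
have [_ n0] := valid_unhit vc h0.
by move=> _; rewrite n0 /load h0 /departures big_ord0 andbT !addn0.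
Qed.

Lemma loop_S_stable x :
  loop_S st sig nu (jumps c) x = #|[pred i : 'I_n | asleep c (x, i)]|%:Z.
Proof.
rewrite /loop_S loop_I_stable -card_sleepy0.
suff : (#|[pred i : 'I_n | asleep c (x, i)]| + jumps c x)%N
  = (#|sleepy0 x| + arrivals c x)%N by lia.
rewrite -sum_load (valid_jumps vc) -sum1_card [X in (X + _)%N]big_mkcond.
rewrite -big_split.
apply: eq_bigr => i _; rewrite -(stable_mass (x, i)) inE /=.
by case: (asleep _ _).
Qed.

End Stable.

End Trajectory.

(** * Stabilization when the useful instructions recur infinitely often *)

Definition unbounded (u : nat -> nat) : Prop := forall B, exists k, (B <= u k)%N.

Definition infinitely_often (P : nat -> Prop) : Prop :=
  forall N, exists2 j, (N <= j)%N & P j.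

Lemma unbounded_le u v C : (forall k, (u k <= v k + C)%N) ->
  unbounded u -> unbounded v.
Proof.
move=> uv uu B; have [k Bk] := uu (B + C)%N; exists k.
by have := uv k; lia.
Qed.

Lemma unbounded_sum (I : finType) (u : I -> nat -> nat) :
  unbounded (fun k => \sum_i u i k)%N -> exists i, unbounded (u i).
Proof.
move=> uu; apply: contrapT => /forallNP bd.
have /choice[B hB] : forall i, exists B, forall k, (u i k < B)%N.
  move=> i; have /existsNP[B nB] := bd i; exists B => k.
  by rewrite ltnNge; apply/negP => Bk; apply: nB; exists k.
have [k] := uu (\sum_i B i).+1; apply/negP; rewrite -leqNgt.
by apply: leq_sum => i _; apply: ltnW.
Qed.

(** Monotonicity of [u] is not assumed: the count over a prefix grows with its length, so one large
    [u k] suffices. *)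
Lemma unbounded_count (P : pred nat) u : infinitely_often P -> unbounded u ->
  unbounded (fun k => \sum_(j < u k) P j)%N.
Proof.
move=> ioP uu B.
have mono : {homo (fun m => \sum_(j < m) P j)%N : m m' / (m <= m')%N}.
  apply: (homo_leq leqnn leq_trans) => m.
  by rewrite big_ord_recr leq_addr.
have [m Bm] : exists m, (B <= \sum_(j < m) P j)%N.
  elim: B => [|B [m Bm]]; first by exists 0%N.
  have [j mj Pj] := ioP m; exists j.+1; rewrite big_ord_recr /= Pj addn1 ltnS.
  exact/(leq_trans Bm)/mono.
by have [k mk] := uu m; exists k; apply/(leq_trans Bm)/mono.
Qed.

Section Stabilization.
Context (R : realType) (V : finType) (n : nat) (st : stacks V n)
  (sleepy0 : V -> {set 'I_n}) (clock : nat -> V * 'I_n -> nat -> R)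
  (nu : V -> R) (p : V -> V -> R).
Implicit Types (c : config V n) (h : V * 'I_n).

Lemma sum_flights (M : V -> nat) :
  ((\sum_x flights st M (Some x)) + flights st M None = \sum_y M y)%N.
Proof.
rewrite /flights exchange_big -big_split; apply: eq_bigr => y _ /=.
rewrite exchange_big -big_split /= -[RHS]card_ord -sum1_card.
apply: eq_bigr => j _; case: (airplane st y j) => [x|]; last by rewrite big1.
rewrite (bigD1 x) //= eqxx big1 // => z zx.
by apply/eqP; rewrite eqb0; apply: contraNneq zx => -[->].
Qed.

Lemma village_balance c x : valid st sleepy0 c ->
  ((\sum_(i < n) (active c (x, i) + asleep c (x, i))) + jumps c x
   = #|sleepy0 x| + arrivals c x)%N.
Proof.
move=> vc; rewrite -(sum_load st) (valid_jumps vc) -big_split.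
by apply: eq_bigr => i _; rewrite -(valid_mass vc (x, i)).
Qed.

(** Particles present plus deaths equal the initial total. Adding all jumps to both sides avoids
    subtraction: [village_balance] absorbs them on the left, and [sum_flights] splits them by
    destination on the right. *)
Lemma conservation arr0 c : valid st sleepy0 c -> balanced st arr0 c ->
  ((\sum_x \sum_(i < n) (active c (x, i) + asleep c (x, i)))
   + flights st (jumps c) None = \sum_x (#|sleepy0 x| + arr0 x))%N.
Proof.
move=> vc bc; apply/eqP; rewrite -(eqn_add2r (\sum_x jumps c x)); apply/eqP.
rewrite addnAC -big_split (eq_bigr _ (fun x _ => village_balance x vc)).
rewrite -(sum_flights (jumps c)) addnA -[in RHS]big_split; congr (_ + _)%N.
by apply: eq_bigr => x _; rewrite bc addnA.
Qed.

Hypotheses (hp : strictly_substochastic_irreducible p)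
  (notice_io : forall h, infinitely_often (notice st h))
  (ticket_io : forall x y, 0 < p x y ->
     infinitely_often (fun j => airplane st x j == Some y))
  (death_io : forall x, \sum_y p x y < 1 ->
     infinitely_often (fun j => airplane st x j == None)).

Lemma kernel_pow_ge0 l x y : 0 <= kernel_pow p l x y.
Proof.
elim: l x => [|l IH] x /=; first by rewrite ler0n.
by apply: sumr_ge0 => z _; rewrite mulr_ge0 ?(kernel_ge0 hp).
Qed.

Let c k := run st clock sleepy0 nu k.
Let arr0 x := Num.truncn (nu x * n%:R).

Let vc k : valid st sleepy0 (c k).
Proof. by have [] := run_spec st sleepy0 clock nu k. Qed.

Let bc k : balanced st arr0 (c k).
Proof. by have [] := run_spec st sleepy0 clock nu k. Qed.

(** Arrivals exceed jumps by at most the particles present in the village, which conservation bounds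
    uniformly in [k]. *)
Lemma unbounded_jumps_arrivals y : unbounded (fun k => arrivals (c k) y) ->
  unbounded (fun k => jumps (c k) y).
Proof.
apply: (unbounded_le (C := (\sum_x (#|sleepy0 x| + arr0 x))%N)) => k.
rewrite -(conservation (vc k) (bc k)) (bigD1 y) //=.
rewrite (leq_trans (leq_addl #|sleepy0 y| _)) // -(village_balance y (vc k)).
by rewrite addnC leq_add2l -addnA leq_addr.
Qed.

Lemma le_flights (M : V -> nat) x v :
  (\sum_(j < M x) (airplane st x j == v) <= flights st M v)%N.
Proof. by rewrite /flights (bigD1 x) //= leq_addr. Qed.

Lemma unbounded_jumps_edge x y : 0 < p x y ->
  unbounded (fun k => jumps (c k) x) -> unbounded (fun k => jumps (c k) y).
Proof.
move=> /ticket_io pxy /(unbounded_count pxy) ux.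
apply: unbounded_jumps_arrivals; apply: (unbounded_le (C := 0)) ux => k.
by rewrite addn0 bc (leq_trans (le_flights _ _ _)) ?leq_addl.
Qed.

Lemma unbounded_jumps_path l x y : 0 < kernel_pow p l x y ->
  unbounded (fun k => jumps (c k) x) -> unbounded (fun k => jumps (c k) y).
Proof.
elim: l x => [|l IH] x /=; first by case: eqP => [->|]; rewrite ?ltxx.
move=> pos; have [z pz] : exists z, 0 < p x z * kernel_pow p l z y.
  apply: contrapT => /forallNP np; move: pos; apply/negP; rewrite -leNgt.
  by apply: sumr_le0 => z _; rewrite leNgt; apply/negP.
have kz : 0 < kernel_pow p l z y.
  rewrite lt_neqAle kernel_pow_ge0 andbT.
  by apply: contraTneq pz => <-; rewrite mulr0 ltxx.
have xz : 0 < p x z.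
  rewrite lt_neqAle (kernel_ge0 hp) andbT.
  by apply: contraTneq pz => <-; rewrite mul0r ltxx.
by move=> /(unbounded_jumps_edge xz); apply: IH.
Qed.

Lemma bounded_jumps x : ~ unbounded (fun k => jumps (c k) x).
Proof.
have [x0 x0lt1] := kernel_sum_lt1 hp; have [l pl] := kernel_irreducible hp x x0.
move=> /(unbounded_jumps_path pl) /(unbounded_count (death_io x0lt1)) dies.
have [k] := dies (\sum_x (#|sleepy0 x| + arr0 x)).+1%N.
apply/negP; rewrite -leqNgt -(conservation (vc k) (bc k)).
by rewrite (leq_trans (le_flights _ _ _)) ?leq_addl.
Qed.

Lemma run_stabilizes : exists k, stable (c k).
Proof.
apply: contrapT => /forallNP nstab.
have cS k : exists2 h, (0 < active (c k) h)%N & c k.+1 = topple st (c k) h.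
  by apply: step_topple; apply/negP/nstab.
(* Every toppling spends exactly one notice, so an endless run exhausts the notices of some house,
   and the jumps among them are unbounded. *)
have used k : (k <= \sum_h notices (c k) h)%N.
  elim: k => [//|k IH]; have [h _ ->] := cS k.
  under eq_bigr do rewrite notices_topple.
  rewrite big_split /= [X in (_ + X)%N](bigD1 h) //= eqxx addnCA add1n ltnS.
  by rewrite (leq_trans IH) ?leq_addr.
have [[x i] uh] : exists h, unbounded (fun k => notices (c k) h).
  by apply: unbounded_sum => B; exists B.
apply: (@bounded_jumps x).
apply: (unbounded_le (C := 0)) (unbounded_count (notice_io (x, i)) uh) => k.
by rewrite addn0 (valid_jumps (vc k)) (bigD1 i) //= leq_addr.
Qed.

End Stabilization.

(** * The fixed point equations for a run that stabilizes *)

Section StableRun.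
Context (R : realType) (V : finType) (n : nat) (st : stacks V n)
  (sleepy0 : V -> {set 'I_n}) (clock : nat -> V * 'I_n -> nat -> R)
  (sig nu : V -> R).

Lemma fixed_point_of_stable : (0 < n)%N ->
  (forall x, #|sleepy0 x| = Num.truncn (sig x * n%:R)) ->
  (exists k, stable (run st clock sleepy0 nu k)) ->
  let m := mstar st clock sleepy0 nu in
  phi_n st sleepy0 sig nu m = m /\ s_n st sig nu m = sstar st clock sleepy0 nu.
Proof.
move=> n0 card [k sk] m; set c := final st clock sleepy0 nu.
have sc : stable c by rewrite /c /final; case: xgetP => [k' //|/(_ k)].
have [vc bc] : valid st sleepy0 c /\
  balanced st (fun x => Num.truncn (nu x * n%:R)) c by apply: run_spec.
(* Scaling back by n gives exact integers, so the truncation loses nothing. *)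
have jE : (fun y => Num.truncn (n%:R * m y)) = jumps c.
  apply/funext => y; rewrite /m /mstar mulrC divfK ?pnatr_eq0 -?lt0n //.
  by rewrite natrK.
split; apply/funext => x.
- by rewrite /phi_n jE (loop_Phi_stable card vc bc sc).
- by rewrite /s_n jE (loop_S_stable card vc bc sc).
Qed.

End StableRun.

(** * Almost sure recurrence of the instructions *)

Lemma ae_infinitely_often (R : realType) (d : measure_display)
    (T : measurableType d) (Pr : probability T R) (I : eqType)
    (F : I -> set (set T)) (idx : nat -> I) (E : nat -> set T) (q : R) :
  mutual_independence Pr F -> injective idx ->
  (forall j, F (idx j) (~` E j)) -> (forall j, measurable (E j)) ->
  0 < q -> (forall j, Pr (E j) = q%:E) ->
  {ae Pr, forall w, infinitely_often (fun j => E j w)}.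
Proof.
move=> indep idx_inj FE mE q0 PE; apply: ae_foralln => N.
(* As in the second Borel-Cantelli lemma: missing all events from N on has probability at most (1 -
   q)^k for every k, hence 0. *)
pose miss := \bigcap_(j in [set j | (N <= j)%N]) ~` E j.
apply: (@negligibleS _ _ _ _ miss) => [w /= nw j Nj Ejw|].
  by apply: nw; exists j.
have mmiss : measurable miss.
  by apply: bigcap_measurable => [|j _]; [exists N => /=|apply: measurableC].
apply/negligibleP => //.
have PEC j : Pr (~` E j) = (1 - q)%:E by rewrite probability_setC // PE.
have q1 : q <= 1 by rewrite -lee_fin -(PE 0%N) probability_le1.
pose G i := ~` E (xget 0%N [set j | idx j = i]).
have GE j : G (idx j) = ~` E j.
  rewrite /G; case: xgetP => [k _ /idx_inj -> //|/(_ j) []//].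
have le_pow k : (Pr miss <= ((1 - q) ^+ k)%:E)%E.
  have -> : ((1 - q) ^+ k)%:E = Pr (\bigcap_(i in [set` map idx (iota N k)]) G i).
    rewrite indep; last 2 first.
    - by rewrite map_inj_uniq ?iota_uniq.
    - by move=> _ /mapP[j _ ->]; rewrite GE.
    rewrite big_map (eq_bigr (fun=> (1 - q)%:E)) => [|j _]; last by rewrite GE PEC.
    by rewrite prodEFin big_const_seq count_predT size_iota -Monoid.iteropE.
  apply: le_measure; rewrite ?inE //.
    apply: fin_bigcap_measurable => // i _.
    by apply: measurableC.
  move=> w mw _ /mapP[j + ->]; rewrite mem_iota => /andP[Nj _].
  by rewrite GE; apply: mw.
have Emiss : Pr miss = (fine (Pr miss))%:E by rewrite fineK ?fin_num_measure.
suff : fine (Pr miss) <= 0.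
  by rewrite -lee_fin -Emiss measure_le0 => /eqP.
have lt1 : `|1 - q| < 1 by rewrite ger0_norm ?subr_ge0 // ltrBlDr ltrDl.
apply: (cvgr_to_ge (cvg_expr lt1)); apply: nearW => k.
by rewrite -lee_fin -Emiss.
Qed.

Section Model.
Context (R : realType) (V : finType) (n : nat) (p : V -> V -> R) (lam : V -> R)
  (d : measure_display) (T : measurableType d) (Pr : probability T R)
  (st : T -> stacks V n) (clock : nat -> V * 'I_n -> nat -> {RV Pr >-> R}).
Hypotheses (lam_ge0 : forall x, 0 <= lam x)
  (model : village_model p lam st clock).

Lemma ae_notice_io h :
  {ae Pr, forall w, infinitely_often (notice (st w) h)}.
Proof.
apply: (ae_infinitely_often (idx := fun j => inl (inr (h, j)) : source V n)
  (E := fun j => [set w | notice (st w) h j = true])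
  (q := 1 / (1 + lam h.1)) (all_independent model)).
- by move=> j k [].
- by move=> j /=; exists (~` [set true]).
- by move=> j; apply: (notice_measurable model).
- by rewrite divr_gt0 // ltr_wpDr.
- by move=> j; apply: (notice_jump model).
Qed.

Lemma ae_airplane_io x v q : 0 < q ->
  (forall j, Pr [set w | airplane (st w) x j = v] = q%:E) ->
  {ae Pr, forall w, infinitely_often (fun j => airplane (st w) x j == v)}.
Proof.
move=> q0 Pv.
have : {ae Pr, forall w, infinitely_often (fun j => airplane (st w) x j = v)}.
  apply: (ae_infinitely_often (idx := fun j => inl (inl (inl (x, j))) : source V n)
    (E := fun j => [set w | airplane (st w) x j = v]) (all_independent model) _ _ _
    q0 Pv).
  - by move=> j k [].
  - by move=> j /=; exists (~` [set v]).
  - by move=> j; apply: (airplane_measurable model).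
by apply: filterS => w io N; have [j Nj /eqP] := io N; exists j.
Qed.

End Model.

Theorem lemma4p9 (R : realType) (V : finType) (n : nat)
    (p : V -> V -> R) (lam sig nu : V -> R) (sleepy0 : V -> {set 'I_n})
    (d : measure_display) (T : measurableType d) (Pr : probability T R)
    (st : T -> stacks V n)
    (clock : nat -> V * 'I_n -> nat -> {RV Pr >-> R})
    (V_nonempty : (0 < #|V|)%N) (n_ge1 : (1 <= n)%N)
    (hp : strictly_substochastic_irreducible p)
    (lam_ge0 : forall x, 0 <= lam x)
    (sig01 : forall x, 0 <= sig x <= 1)
    (nu_ge0 : forall x, 0 <= nu x)
    (card_sleepy0 : forall x, #|sleepy0 x| = Num.truncn (sig x * n%:R))
    (model : village_model p lam st clock) :
  {ae Pr, forall w,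
    let m := mstar (st w) (fun k h q => clock k h q w) sleepy0 nu in
    phi_n (st w) sleepy0 sig nu m = m /\
    s_n (st w) sig nu m = sstar (st w) (fun k h q => clock k h q w) sleepy0 nu}.
Proof.
(* Houses and villages are finite in number, so the almost sure events can be intersected; the rest
   is deterministic, for whatever clocks [w] gives. *)
have notice_io : {ae Pr, forall w, forall h, infinitely_often (notice (st w) h)}.
  by apply: filter_forall => h; apply: (ae_notice_io lam_ge0 model).
have ticket_io : {ae Pr, forall w, forall x y, 0 < p x y ->
    infinitely_often (fun j => airplane (st w) x j == Some y)}.
  apply: filter_forall => x; apply: filter_forall => y.
  have [pxy|_] := ltP 0 (p x y); last exact: aeW.
  apply: filterS (ae_airplane_io model pxy
    (fun j => airplane_law model x j y)) => w //.
have death_io : {ae Pr, forall w, forall x, \sum_y p x y < 1 ->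
    infinitely_often (fun j => airplane (st w) x j == None)}.
  apply: filter_forall => x.
  have [px|_] := ltP (\sum_y p x y) 1; last exact: aeW.
  rewrite -subr_gt0 in px.
  apply: filterS (ae_airplane_io model px
    (airplane_graveyard model x)) => w //.
apply: filterS3 notice_io ticket_io death_io => w nio tio dio.
apply: fixed_point_of_stable => //.
exact: (run_stabilizes sleepy0 _ nu hp nio tio dio).
Qed.
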